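(* (i) Suppose that $(\bar x,\bar y)$ is locally optimal to (BP) restricted on $U(\bar x)\times U(\bar y)$, where $U(\bar x)$, $U(\bar y)$ are neighborhoods of $\bar x$, $\bar y$, and that $(\mathrm{P}_{\bar x})$ satisfies the Guignard constraint qualification at some optimal solution $\bar z$, with $\{\bar u,\bar v\}$ being the corresponding Lagrange multipliers. Under any conditions ensuring weak Mond-Weir duality for $(\mathrm{P}_x)$ and $(\mathrm{MD}_x)$ for $x\in U(\bar x)$, $(\bar x,\bar y,\bar z,\bar u,\bar v)$ is locally optimal to (MDP). (ii) Conversely, if $(\bar x,\bar y,\bar z,\bar u,\bar v)$ is locally optimal to (MDP) restricted on $U(\bar x)\times U(\bar y)\times U(\bar z)\times\mathbb{R}^p\times\mathbb{R}^q$, where $U(\bar x),U(\bar y),U(\bar z)$ are neighborhoods of $\bar x,\bar y,\bar z$ with $U(\bar y)\subseteq U(\bar z)$, and $(\mathrm{P}_x)$ satisfies the Guignard constraint qualification at all points in $S(x)$ for any $x\in U(\bar x)$, then $(\bar x,\bar y)$ is locally optimal to (BP).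
   Context: Data: $\Omega\subseteq\mathbb{R}^{n+m}$ is a set; $F:\mathbb{R}^{n+m}\to\mathbb{R}$ is continuously differentiable; $f:\mathbb{R}^{n+m}\to\mathbb{R}$, $g:\mathbb{R}^{n+m}\to\mathbb{R}^p$, $h:\mathbb{R}^{n+m}\to\mathbb{R}^q$ are twice continuously differentiable. For $x\in\mathbb{R}^n$, the lower-level problem is $(\mathrm{P}_x)$: $\min_y f(x,y)$ s.t. $g(x,y)\le 0$, $h(x,y)=0$; its feasible set is $Y(x)=\{y\in\mathbb{R}^m: g(x,y)\le0,\ h(x,y)=0\}$ and its set of (global) optimal solutions is $S(x)$. Let $X=\{x\in\mathbb{R}^n:\exists y\in\mathbb{R}^m,\ (x,y)\in\Omega\}$. Standing assumption: $S(x)\ne\emptyset$ for each $x\in X$. The bilevel program is (BP): $\min F(x,y)$ s.t. $(x,y)\in\Omega$, $y\in S(x)$. Lagrangian: $L(x,z,u,v)=f(x,z)+u^Tg(x,z)+v^Th(x,z)$; $\nabla_z$ denotes the gradient with respect to the second block of variables, and for vector-valued maps the matrix whose columns are the gradients of the components. The lower-level Mond-Weir dual is $(\mathrm{MD}_x)$: $\max_{z,u,v} f(x,z)$ s.t. $\nabla_zL(x,z,u,v)=0$, $u^Tg(x,z)+v^Th(x,z)\ge0$, $u\ge0$; its feasible set is $M(x)$. Weak Mond-Weir duality for $(\mathrm{P}_x)$ and $(\mathrm{MD}_x)$ means that the optimal value of $(\mathrm{P}_x)$ is no less than that of $(\mathrm{MD}_x)$, i.e. $\min_{y'\in Y(x)}f(x,y')\ge\max_{(z',u',v')\in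 M(x)}f(x,z')$. (MDP): minimize $F(x,y)$ over $(x,y,z,u,v)\in\mathbb{R}^n\times\mathbb{R}^m\times\mathbb{R}^m\times\mathbb{R}^p\times\mathbb{R}^q$ s.t. $(x,y)\in\Omega$, $g(x,y)\le0$, $h(x,y)=0$, $f(x,y)-f(x,z)\le0$, $u^Tg(x,z)+v^Th(x,z)\ge0$, $\nabla_zf(x,z)+\nabla_zg(x,z)u+\nabla_zh(x,z)v=0$, $u\ge0$. A point is locally optimal restricted on a set $U$ containing it if it is feasible and its objective value is no larger than that of every feasible point in $U$; it is locally optimal if this holds for some neighborhood $U$ of it. Lagrange multipliers $\{\bar u,\bar v\}$ of $(\mathrm{P}_{\bar x})$ corresponding to $\bar z$ satisfy $\nabla_zL(\bar x,\bar z,\bar u,\bar v)=0$, $\bar u\ge0$, $\bar u^Tg(\bar x,\bar z)=0$. Guignard constraint qualification for $(\mathrm{P}_x)$ at $\bar y\in Y(x)$: $\mathcal{L}_{Y(x)}(\bar y)^\circ=\mathcal{T}_{Y(x)}(\bar y)^\circ$, where $\mathcal{T}_{Y(x)}(\bar y)=\{d\in\mathbb{R}^m:\exists\{y^k\}\subseteq Y(x),\ \exists\, \{t_k\}\downarrow0,\ y^k\to\bar y,\ (y^k-\bar y)/t_k\to d\}$, $\mathcal{L}_{Y(x)}(\bar y)=\{d\in\mathbb{R}^m:\nabla_yg_i(x,\bar y)^Td\le0 \text{ for all } i \text{ with } g_i(x,\bar y)=0,\ \nabla_yh_j(x,\bar y)^Td=0,\ j=1,\dots,q\}$, and $D^\circ=\{d\in\mathbb{R}^m:d^Ty\le0\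 \text{for all } y\in D\}$ for a cone $D\subset\mathbb{R}^m$.
   Formalization: In part (ii), weak Mond-Weir duality at x̄ is assumed in addition (inherited from part (i)); without it (ii) fails, e.g. for f = y⁴ − y², F = y² with no lower-level constraints at the point (0,0,0). *)

(* Defs.v *)
From HB Require Import structures.
From mathcomp Require Import all_boot all_order all_algebra.
From mathcomp Require Import all_classical all_reals all_analysis.

Set Implicit Arguments.
Unset Strict Implicit.
Unset Printing Implicit Defensive.

Import Order.TTheory GRing.Theory Num.Theory.
Import numFieldNormedType.Exports.

Local Open Scope classical_set_scope.
Local Open Scope ring_scope.

(* R^(n+m) is the product 'rV[R]_n * 'rV[R]_m of spaces of row vectors. *)

Section Smoothness.
Context {R : realType}.

(* Between finite-dimensional spaces, continuity of the directional derivative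
   in every fixed direction is continuity of the differential. *)
Definition C1 (V W : normedModType R) (phi : V -> W) : Prop :=
  (forall a, differentiable phi a) /\
  (forall v, continuous (fun a => 'D_v phi a)).

Definition C2 (V W : normedModType R) (phi : V -> W) : Prop :=
  C1 phi /\ (forall v, C1 (fun a => 'D_v phi a)).

End Smoothness.

Section Vectors.
Context {R : realType}.

Definition dot k (a b : 'rV[R]_k) : R := \sum_i a 0 i * b 0 i.

Definition nonneg k (a : 'rV[R]_k) : Prop := forall i, 0 <= a 0 i.

Definition nonpos k (a : 'rV[R]_k) : Prop := forall i, a 0 i <= 0.

Definition grad k (phi : 'rV[R]_k -> R) (a : 'rV[R]_k) : 'rV[R]_k :=
  \row_i 'D_(delta_mx 0 i) phi a.

(* Since 'J acts on row vectors by right multiplication, 'J phi a is the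
   k x l matrix whose columns are the gradients of the components of phi;
   gradmul phi a u is the transpose of (nabla phi(a)) u. *)
Definition gradmul k l (phi : 'rV[R]_k -> 'rV[R]_l) (a : 'rV[R]_k)
    (u : 'rV[R]_l) : 'rV[R]_k :=
  u *m ('J phi a)^T.

Definition polar k (D : set 'rV[R]_k) : set 'rV[R]_k :=
  [set d | forall y, D y -> dot d y <= 0].

Definition tangent_cone k (A : set 'rV[R]_k) (a : 'rV[R]_k) :
    set 'rV[R]_k :=
  [set d | exists (y : nat -> 'rV[R]_k) (t : nat -> R),
     [/\ forall j, A (y j),
         forall j, 0 < t j,
         t j @[j --> \oo] --> (0 : R),
         y j @[j --> \oo] --> a &
         (t j)^-1 *: (y j - a) @[j --> \oo] --> d]].

End Vectors.

Section LocalOptimality.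
Context {R : realType} {T : topologicalType}.

Definition optimal_on (obj : T -> R) (feas U : set T) (w : T) : Prop :=
  [/\ U w, feas w & forall w', feas w' -> U w' -> obj w <= obj w'].

Definition locally_optimal (obj : T -> R) (feas : set T) (w : T) : Prop :=
  exists2 U : set T, nbhs w U & optimal_on obj feas U w.

End LocalOptimality.

Section Bilevel.
Context {R : realType} {n m p q : nat}.
Variables (Omega : set ('rV[R]_n * 'rV[R]_m)).
Variables (F f : 'rV[R]_n * 'rV[R]_m -> R).
Variables (g : 'rV[R]_n * 'rV[R]_m -> 'rV[R]_p).
Variables (h : 'rV[R]_n * 'rV[R]_m -> 'rV[R]_q).

Definition lower_feasible (x : 'rV[R]_n) : set 'rV[R]_m :=
  [set y | nonpos (g (x, y)) /\ h (x, y) = 0].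

Definition lower_solutions (x : 'rV[R]_n) : set 'rV[R]_m :=
  [set y | lower_feasible x y /\
           forall y', lower_feasible x y' -> f (x, y) <= f (x, y')].

Definition upper_domain : set 'rV[R]_n := [set x | exists y, Omega (x, y)].

Definition BP_feasible : set ('rV[R]_n * 'rV[R]_m) :=
  [set w | Omega w /\ lower_solutions w.1 w.2].

Definition lagrangian (x : 'rV[R]_n) (z : 'rV[R]_m) (u : 'rV[R]_p)
    (v : 'rV[R]_q) : R :=
  f (x, z) + dot u (g (x, z)) + dot v (h (x, z)).

Definition lagrange_multipliers (x : 'rV[R]_n) (z : 'rV[R]_m)
    (u : 'rV[R]_p) (v : 'rV[R]_q) : Prop :=
  [/\ grad (fun z' => lagrangian x z' u v) z = 0,
      nonneg u & dot u (g (x, z)) = 0].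

Definition MD_feasible (x : 'rV[R]_n) :
    set ('rV[R]_m * 'rV[R]_p * 'rV[R]_q) :=
  [set w | let: (z, u, v) := w in
     [/\ grad (fun z' => lagrangian x z' u v) z = 0,
         0 <= dot u (g (x, z)) + dot v (h (x, z)) &
         nonneg u]].

(* The extended reals cover empty feasible sets and unattained values. *)
Definition weak_MW_duality (x : 'rV[R]_n) : Prop :=
  (ereal_sup [set (f (x, w.1.1))%:E | w in MD_feasible x] <=
   ereal_inf [set (f (x, y))%:E | y in lower_feasible x])%E.

Definition MDP_feasible :
    set ('rV[R]_n * 'rV[R]_m * 'rV[R]_m * 'rV[R]_p * 'rV[R]_q) :=
  [set w | let: (x, y, z, u, v) := w in
     [/\ Omega (x, y), nonpos (g (x, y)) & h (x, y) = 0] /\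
     [/\ f (x, y) - f (x, z) <= 0,
         0 <= dot u (g (x, z)) + dot v (h (x, z)),
         grad (fun z' => f (x, z')) z
           + gradmul (fun z' => g (x, z')) z u
           + gradmul (fun z' => h (x, z')) z v = 0 &
         nonneg u]].

Definition MDP_objective
    (w : 'rV[R]_n * 'rV[R]_m * 'rV[R]_m * 'rV[R]_p * 'rV[R]_q) : R :=
  let: (x, y, _, _, _) := w in F (x, y).

Definition linearized_cone (x : 'rV[R]_n) (y : 'rV[R]_m) :
    set 'rV[R]_m :=
  [set d | (forall i, g (x, y) 0 i = 0 ->
              dot (grad (fun y' => g (x, y') 0 i) y) d <= 0) /\
           (forall j, dot (grad (fun y' => h (x, y') 0 j) y) d = 0)].

Definition guignard_cq (x : 'rV[R]_n) (y : 'rV[R]_m) : Prop :=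
  polar (linearized_cone x y) = polar (tangent_cone (lower_feasible x) y).

End Bilevel.

(* Main.v *)
Require Import Defs.
From HB Require Import structures.
From mathcomp Require Import all_boot all_order all_algebra.
From mathcomp Require Import all_classical all_reals all_analysis.
Import Order.TTheory GRing.Theory Num.Theory.
Import numFieldNormedType.Exports.
Local Open Scope classical_set_scope.
Local Open Scope ring_scope.

(* Weak Mond-Weir duality at x turns f(x,y) <= f(x,z) <= f(x,y'), for z
   dual-feasible and y' in Y(x), into y \in S(x), so MDP-feasible points project
   onto BP-feasible ones.  Conversely a BP-feasible (x,y) lifts to the
   MDP-feasible point (x,y,y,u,v), where u,v are KKT multipliers at y: at a
   minimiser the negative gradient of f lies in the polar of the tangent cone,
   by Guignard in the polar of the linearized cone, and Farkas' lemma
   provides the multipliers. *)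

(** * Dot product and Farkas' lemma *)

Lemma dotDl {R : realType} k (a b c : 'rV[R]_k) :
  dot (a + b) c = dot a c + dot b c.
Proof.
by rewrite /dot -big_split; apply: eq_bigr => i _; rewrite mxE mulrDl.
Qed.

Lemma dotZl {R : realType} k (x : R) (a b : 'rV[R]_k) :
  dot (x *: a) b = x * dot a b.
Proof. by rewrite /dot mulr_sumr; apply: eq_bigr => i _; rewrite mxE mulrA. Qed.

Lemma dotC {R : realType} k (a b : 'rV[R]_k) : dot a b = dot b a.
Proof. by apply: eq_bigr => i _; rewrite mulrC. Qed.

Lemma dotNl {R : realType} k (a b : 'rV[R]_k) : dot (- a) b = - dot a b.
Proof. by rewrite -scaleN1r dotZl mulN1r. Qed.

Lemma dot0r {R : realType} k (a : 'rV[R]_k) : dot a 0 = 0.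
Proof. by apply: big1 => i _; rewrite mxE mulr0. Qed.

Lemma dot_self_le0 {R : realType} k (a : 'rV[R]_k) : dot a a <= 0 -> a = 0.
Proof.
move=> a0; apply/rowP => i; rewrite mxE; apply/eqP.
rewrite -sqrf_eq0 eq_le sqr_ge0 andbT; apply: le_trans a0.
rewrite /dot (bigD1 i)//= expr2 lerDl sumr_ge0// => j _.
by rewrite -expr2 sqr_ge0.
Qed.

(* Bartl's induction: if the constraints other than [a ord0] do not suffice, some
   x satisfies them with [0 < dot b x], hence violates [a ord0]; projecting along
   x onto the kernel of [a ord0] removes that constraint. *)
Lemma farkas_ord {R : realType} k N (a : 'I_N -> 'rV[R]_k) (b : 'rV[R]_k) :
  (forall d, (forall i, dot (a i) d <= 0) -> dot b d <= 0) ->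
  exists2 l : 'I_N -> R, forall i, 0 <= l i & b = \sum_i l i *: a i.
Proof.
elim: N a b => [|N IHN] a b ab.
  (* With no constraints every direction is admissible, in particular [b] itself, which forces
     [b = 0]. *)
  exists (fun=> 0) => //; rewrite big_ord0; apply: dot_self_le0.
  by apply: ab => -[].
pose a' i := a (lift ord0 i).
have [ab'|/existsNP[x /not_implyP[a'x /negP]]] :=
    pselect (forall d, (forall i, dot (a' i) d <= 0) -> dot b d <= 0).
  have [l l0 ->] := IHN a' b ab'.
  exists (fun i => if unlift ord0 i is Some j then l j else 0).
    by move=> i; case: unliftP.
  rewrite big_ord_recl unlift_none scale0r add0r.
  by apply: eq_bigr => i _; rewrite liftK.
rewrite -ltNge => bx.
have a0x : 0 < dot (a ord0) x.
  rewrite ltNge; apply/negP => a0x; move: bx; rewrite ltNge ab// => i.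
  by have [j ->|->//] := unliftP ord0 i; exact: a'x.
pose s (c : 'rV[R]_k) := dot c x / dot (a ord0) x.
pose P c := c - s c *: a ord0.
(* [P] is the adjoint of the projection onto the kernel of [a ord0] along [x]: testing [P c] on [d]
   amounts to testing [c] on the projected vector, where [a ord0] vanishes. *)
have dotP c d :
    dot (P c) d = dot c (d - (dot (a ord0) d / dot (a ord0) x) *: x).
  rewrite [RHS]dotC !dotDl !dotNl !dotZl /s (dotC _ x c) (dotC _ d c).
  by congr (_ - _); rewrite mulrAC [RHS]mulrAC (mulrC (dot c x)).
have [|l l0 PbE] := IHN (fun i => P (a' i)) (P b).
  move=> d Pad; rewrite dotP; apply: ab => i.
  have [j ->|->] := unliftP ord0 i; first by rewrite -dotP; exact: Pad.
  by rewrite dotC dotDl dotNl dotZl (dotC _ x) divfK ?gt_eqF// dotC subrr.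
(* The coefficient of [a ord0] is forced by expanding [P] in [PbE]. It is nonnegative because [s b]
   is positive while every [s (a' j)] is nonpositive, by the choice of [x]. *)
exists (fun i => if unlift ord0 i is Some j then l j
                 else s b - \sum_j l j * s (a' j)).
  move=> i; case: unliftP => // _; rewrite subr_ge0.
  apply: (@le_trans _ _ 0); last by rewrite divr_ge0// ltW.
  apply: sumr_le0 => j _; rewrite mulr_ge0_le0//.
  by rewrite pmulr_lle0 ?invr_gt0// a'x.
rewrite big_ord_recl unlift_none scalerBl scaler_suml.
under [X in _ = _ + X]eq_bigr do rewrite liftK.
rewrite -[LHS](subrK (s b *: a ord0)) -/(P b) PbE [LHS]addrC -addrA.
congr (_ + _); rewrite addrC -sumrB; apply: eq_bigr => j _.
by rewrite scalerBr scalerA.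
Qed.

(** Transport along [enum_val], so that a sum type can index the constraints. *)
Lemma farkas {R : realType} k (I : finType) (a : I -> 'rV[R]_k) (b : 'rV[R]_k) :
  (forall d, (forall i, dot (a i) d <= 0) -> dot b d <= 0) ->
  exists2 l : I -> R, forall i, 0 <= l i & b = \sum_i l i *: a i.
Proof.
move=> ab; have [|l l0 ->] := @farkas_ord R k #|I| (a \o enum_val) b.
  by move=> d ad; apply: ab => i; rewrite -(enum_rankK i); exact: ad.
exists (l \o enum_rank) => [i|]; first exact: l0.
rewrite (reindex (@enum_val I I)) /=; last first.
  by apply: onW_bij; exact: enum_val_bij.
by apply: eq_bigr => i _; rewrite enum_valK.
Qed.

(** Each equality splits into two opposite inequalities; its sign-free multiplier is the difference
    of the two nonnegative ones. *)
Lemma farkas_eq {R : realType} k (I J : finType) (a : I -> 'rV[R]_k)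
    (c : J -> 'rV[R]_k) (b : 'rV[R]_k) :
  (forall d, (forall i, dot (a i) d <= 0) -> (forall j, dot (c j) d = 0) ->
     dot b d <= 0) ->
  exists (l : I -> R) (r : J -> R),
    (forall i, 0 <= l i) /\ b = \sum_i l i *: a i + \sum_j r j *: c j.
Proof.
move=> abc; pose e (s : I + (J + J)) := match s with
  | inl i => a i | inr (inl j) => c j | inr (inr j) => - c j end.
have [|l l0 ->] := @farkas R k _ e b.
  move=> d ed; apply: abc => [i|j]; first exact: (ed (inl i)).
  apply/eqP; rewrite eq_le (ed (inr (inl j))) /=.
  by have := ed (inr (inr j)); rewrite dotNl oppr_le0.
exists (l \o inl), (fun j => l (inr (inl j)) - l (inr (inr j))).
split=> [i|]; first exact: l0.
rewrite !big_sumType /=; congr (_ + _); rewrite -big_split.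
by apply: eq_bigr => j _; rewrite scalerN scalerBl.
Qed.

(** * Gradients of slices, components and pairings *)

Lemma differentiable_slice {R : realType} (U V W : normedModType R)
    (phi : U * V -> W) (x : U) (y : V) :
  differentiable phi (x, y) -> differentiable (fun y' => phi (x, y')) y.
Proof.
move=> dphi.
apply: (@differentiable_comp _ _ _ _ (fun y' => (x, y')) phi) => //.
Qed.

Lemma dot_grad {R : realType} k (phi : 'rV[R]_k -> R) (a d : 'rV[R]_k) :
  differentiable phi a -> dot (grad phi a) d = 'd phi a d.
Proof.
move=> dphi; rewrite [in RHS](row_sum_delta d) linear_sum.
by apply: eq_bigr => i _; rewrite mxE deriveE// linearZ /= mulrC.
Qed.


Lemma derive_coord {R : realType} (V : normedModType R) l
    (phi : V -> 'rV[R]_l) (a v : V) i : differentiable phi a ->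
  'D_v (fun y => phi y 0 i) a = ('D_v phi a) 0 i.
Proof.
by move=> dphi; rewrite derive_mx ?mxE//; exact: diff_derivable.
Qed.

Lemma differentiable_coord_comp {R : realType} (V : normedModType R) l
    (phi : V -> 'rV[R]_l) (a : V) i : differentiable phi a ->
  differentiable (fun y => phi y 0 i) a.
Proof.
move=> dphi.
apply: (@differentiable_comp _ _ _ _ phi (fun M : 'rV[R]_l => M 0 i)) => //.
exact: differentiable_coord.
Qed.

(** Links the Jacobian form of stationarity in [MDP_feasible] to the componentwise gradients of
    [linearized_cone], to which Farkas applies. *)
Lemma gradmulE {R : realType} k l (phi : 'rV[R]_k -> 'rV[R]_l) a u :
  differentiable phi a ->
  gradmul phi a u = \sum_i u 0 i *: grad (fun y => phi y 0 i) a.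
Proof.
move=> dphi; apply/rowP => j; rewrite mxE summxE; apply: eq_bigr => i _.
by rewrite !mxE derive_coord// deriveE.
Qed.

Lemma gradD {R : realType} k (phi psi : 'rV[R]_k -> R) a :
  differentiable phi a -> differentiable psi a ->
  grad (fun y => phi y + psi y) a = grad phi a + grad psi a.
Proof.
move=> dphi dpsi; apply/rowP => j; rewrite !mxE.
by rewrite (@deriveD _ _ _ phi psi)//; exact: diff_derivable.
Qed.

Lemma differentiable_dot {R : realType} k l (phi : 'rV[R]_k -> 'rV[R]_l) a u :
  differentiable phi a -> differentiable (fun y => dot u (phi y)) a.
Proof.
move=> dphi.
rewrite (_ : (fun _ => _) = \sum_i (fun y => u 0 i *: phi y 0 i)); last first.
  by apply/funext => y; rewrite fct_sumE.
apply: differentiable_sum => i; apply: differentiableZ.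
exact: differentiable_coord_comp.
Qed.

Lemma grad_dot {R : realType} k l (phi : 'rV[R]_k -> 'rV[R]_l) a u :
  differentiable phi a -> grad (fun y => dot u (phi y)) a = gradmul phi a u.
Proof.
move=> dphi; rewrite gradmulE//; apply/rowP => j; rewrite mxE summxE.
have dc i := @diff_derivable _ _ _ _ _ (delta_mx 0 j)
  (@differentiable_coord_comp _ _ _ phi a i dphi).
rewrite (_ : (fun _ => _) = \sum_i (fun y => u 0 i *: phi y 0 i)); last first.
  by apply/funext => y; rewrite fct_sumE.
rewrite derive_sum => [|i]; last exact: derivableZ.
by apply: eq_bigr => i _; rewrite !mxE deriveZ.
Qed.

(** * First-order optimality and multipliers *)

Lemma tangent_diff_ge0 {R : realType} k (phi : 'rV[R]_k -> R) (A : set 'rV[R]_k)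
    (a d : 'rV[R]_k) :
  differentiable phi a -> (forall y, A y -> phi a <= phi y) ->
  tangent_cone A a d -> 0 <= 'd phi a d.
Proof.
move=> dphi amin [y [t [Ay t0 t_cvg y_cvg yd]]].
(* The slack [e * |d|] absorbs the first-order remainder and vanishes with [e]; the [+ 1] below
   covers [d = 0]. *)
suff Hle e : 0 < e -> 0 <= 'd phi a d + e * `|d|.
  apply/ler_addgt0Pr => e e0; have d1 : 0 < `|d| + 1 by rewrite ltr_wpDl.
  apply: le_trans (Hle (e / (`|d| + 1)) _) _; first by rewrite divr_gt0.
  by rewrite lerD2l mulrAC ler_pdivrMr// ler_pM2l// lerDl.
move=> e0; pose w j := (t j)^-1 *: (y j - a).
have w_cvg :
    ('d phi a (w j) + e * `|w j|) @[j --> \oo] --> 'd phi a d + e * `|d|.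
  apply: cvgD.
    by apply: (@cvg_comp _ _ _ w ('d phi a)) yd _; exact: diff_continuous.
  by apply: cvgM; [exact: cvg_cst|exact: (cvg_norm yd)].
have small : \forall x \near a,
    `|phi x - (phi a + 'd phi a (x - a))| <= e * `|x - a|.
  have /funext/eqaddoP/(_ e e0) := @diffE _ _ _ _ _ dphi.
  by rewrite lim_id.
rewrite -(cvg_lim _ w_cvg)//; apply: limr_ge.
  by apply/cvg_ex; eexists; exact: w_cvg.
near=> j.
have tw : y j - a = t j *: w j by rewrite scalerA divff ?scale1r// gt_eqF.
have : `|phi (y j) - (phi a + 'd phi a (y j - a))| <= e * `|y j - a|.
  by near: j; exact: (y_cvg _ small).
(* Minimality bounds [phi (y j)] below by [phi a], and the common factor [t j > 0] then cancels. *)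
rewrite tw linearZ normrZ gtr0_norm// mulrCA => /(le_trans (ler_norm _)).
rewrite lerBlDr addrCA => /(le_trans (amin _ (Ay j))).
by rewrite lerDl addrC -mulrDr pmulr_rge0.
Unshelve. all: by end_near. Qed.

(** Reconciles stationarity as written in [MD_feasible] and [lagrange_multipliers] with its expanded
    form in [MDP_feasible]. *)
Lemma grad_lagrangian {R : realType} n m p q
    (f : 'rV[R]_n * 'rV[R]_m -> R) (g : 'rV[R]_n * 'rV[R]_m -> 'rV[R]_p)
    (h : 'rV[R]_n * 'rV[R]_m -> 'rV[R]_q) x z u v :
  differentiable f (x, z) -> differentiable g (x, z) ->
  differentiable h (x, z) ->
  grad (fun z' => lagrangian f g h x z' u v) z =
    grad (fun z' => f (x, z')) z + gradmul (fun z' => g (x, z')) z u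
      + gradmul (fun z' => h (x, z')) z v.
Proof.
move=> /differentiable_slice df /differentiable_slice dg.
move=> /differentiable_slice dh.
rewrite /lagrangian gradD; last exact: differentiable_dot.
  rewrite gradD//; last exact: differentiable_dot.
  by rewrite !grad_dot.
by apply: differentiableD => //; exact: differentiable_dot.
Qed.

Lemma guignard_lagrange_multipliers {R : realType} n m p q
    (f : 'rV[R]_n * 'rV[R]_m -> R) (g : 'rV[R]_n * 'rV[R]_m -> 'rV[R]_p)
    (h : 'rV[R]_n * 'rV[R]_m -> 'rV[R]_q) x y :
  differentiable f (x, y) -> differentiable g (x, y) ->
  differentiable h (x, y) ->
  lower_solutions f g h x y -> guignard_cq g h x y ->
  exists u v, lagrange_multipliers f g h x y u v.
Proof.
move=> df dg dh [yfeas ymin] cq.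
have dfx := @differentiable_slice _ _ _ _ _ _ _ df.
have dgx := @differentiable_slice _ _ _ _ _ _ _ dg.
have dhx := @differentiable_slice _ _ _ _ _ _ _ dh.
have : polar (tangent_cone (lower_feasible g h x) y)
    (- grad (fun y' => f (x, y')) y).
  move=> d dT; rewrite dotNl oppr_le0 dot_grad//.
  exact: tangent_diff_ge0 dT.
rewrite -cq => gradf_polar.
(* Inactive constraints are replaced by the zero vector, so all of ['I_p] can serve as index set. *)
pose a i := if g (x, y) 0 i == 0 then grad (fun y' => g (x, y') 0 i) y else 0.
have [|l [r [l0 gradfE]]] := @farkas_eq _ _ _ _ a
    (fun j => grad (fun y' => h (x, y') 0 j) y)
    (- grad (fun y' => f (x, y')) y).
  move=> d ad cd; apply: gradf_polar; split=> // i /eqP gi0.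
  by have := ad i; rewrite /a gi0.
(* Farkas leaves [l i] arbitrary at inactive indices; resetting it to 0 keeps the sum and yields
   complementarity. *)
exists (\row_i (if g (x, y) 0 i == 0 then l i else 0)), (\row_j r j).
split=> [|i|].
- rewrite grad_lagrangian// !gradmulE// -addrA; apply/eqP.
  rewrite -[X in X + _]opprK addrC subr_eq0 gradfE eq_sym; apply/eqP.
  congr (_ + _); apply: eq_bigr => i _; rewrite mxE /a//.
  by case: ifP => _; rewrite ?scaler0 ?scale0r.
- by rewrite mxE; case: ifP.
- by apply: big1 => i _; rewrite mxE; case: eqP => [->|]; rewrite ?mulr0 ?mul0r.
Qed.

(** * Transfer between the bilevel and Mond-Weir programs *)

Lemma weak_duality_BP_feasible {R : realType} n m p q
    (Omega : set ('rV[R]_n * 'rV[R]_m)) (f : 'rV[R]_n * 'rV[R]_m -> R)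
    (g : 'rV[R]_n * 'rV[R]_m -> 'rV[R]_p)
    (h : 'rV[R]_n * 'rV[R]_m -> 'rV[R]_q) x y z u v :
  differentiable f (x, z) -> differentiable g (x, z) ->
  differentiable h (x, z) -> weak_MW_duality f g h x ->
  MDP_feasible Omega f g h (x, y, z, u, v) -> BP_feasible Omega f g h (x, y).
Proof.
move=> df dg dh duality [[Oxy gxy hxy] [fyz dual grad0 u0]].
split=> //; split=> // y' y'feas; rewrite subr_le0 in fyz.
apply: le_trans fyz _; rewrite -lee_fin.
apply: le_trans (le_trans duality _); last first.
  by apply: ereal_inf_lbound; exists y'.
apply: ereal_sup_ubound; exists (z, u, v) => //=.
by split=> //; rewrite grad_lagrangian.
Qed.

(** Two lower-level solutions share their optimal value, and complementarity with [h (x, z) = 0]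
    makes the dual inequality an equality. Part (i) uses [z = zb], part (ii) [z = y]. *)
Lemma multipliers_MDP_feasible {R : realType} n m p q
    (Omega : set ('rV[R]_n * 'rV[R]_m)) (f : 'rV[R]_n * 'rV[R]_m -> R)
    (g : 'rV[R]_n * 'rV[R]_m -> 'rV[R]_p)
    (h : 'rV[R]_n * 'rV[R]_m -> 'rV[R]_q) x y z u v :
  differentiable f (x, z) -> differentiable g (x, z) ->
  differentiable h (x, z) -> BP_feasible Omega f g h (x, y) ->
  lower_solutions f g h x z -> lagrange_multipliers f g h x z u v ->
  MDP_feasible Omega f g h (x, y, z, u, v).
Proof.
move=> df dg dh [Oxy [[gxy hxy] ymin]] [[gxz hxz] _] [grad0 u0 ug0].
split=> //; split=> //; first by rewrite subr_le0 ymin.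
- by rewrite ug0 hxz dot0r addr0.
- by rewrite -grad_lagrangian.
Qed.

Lemma nbhs_setXT (S T : topologicalType) (s : S) (t : T) (A : set S) :
  nbhs s A -> nbhs (s, t) (A `*` setT).
Proof. by move=> sA; exists (A, setT) => //; split=> //; exact: filterT. Qed.

Theorem theorem3p3 (R : realType) (n m p q : nat)
    (Omega : set ('rV[R]_n * 'rV[R]_m))
    (F f : 'rV[R]_n * 'rV[R]_m -> R)
    (g : 'rV[R]_n * 'rV[R]_m -> 'rV[R]_p)
    (h : 'rV[R]_n * 'rV[R]_m -> 'rV[R]_q)
    (HF : C1 F) (Hf : C2 f) (Hg : C2 g) (Hh : C2 h)
    (HS : forall x, upper_domain Omega x ->
            lower_solutions f g h x !=set0) :
  (forall (xb : 'rV[R]_n) (yb zb : 'rV[R]_m)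
          (ub : 'rV[R]_p) (vb : 'rV[R]_q)
          (Ux : set 'rV[R]_n) (Uy : set 'rV[R]_m),
     nbhs xb Ux -> nbhs yb Uy ->
     optimal_on F (BP_feasible Omega f g h) (Ux `*` Uy) (xb, yb) ->
     lower_solutions f g h xb zb ->
     guignard_cq g h xb zb ->
     lagrange_multipliers f g h xb zb ub vb ->
     (forall x, Ux x -> weak_MW_duality f g h x) ->
     locally_optimal (MDP_objective F) (MDP_feasible Omega f g h)
       (xb, yb, zb, ub, vb)) /\
  (forall (xb : 'rV[R]_n) (yb zb : 'rV[R]_m)
          (ub : 'rV[R]_p) (vb : 'rV[R]_q)
          (Ux : set 'rV[R]_n) (Uy Uz : set 'rV[R]_m),
     nbhs xb Ux -> nbhs yb Uy -> nbhs zb Uz ->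
     Uy `<=` Uz ->
     optimal_on (MDP_objective F) (MDP_feasible Omega f g h)
       (Ux `*` Uy `*` Uz `*` [set: 'rV[R]_p] `*` [set: 'rV[R]_q])
       (xb, yb, zb, ub, vb) ->
     (forall x, Ux x ->
        forall y, lower_solutions f g h x y -> guignard_cq g h x y) ->
     weak_MW_duality f g h xb ->
     locally_optimal F (BP_feasible Omega f g h) (xb, yb)).
Proof.
have df := Hf.1.1; have dg := Hg.1.1; have dh := Hh.1.1.
split=> [xb yb zb ub vb Ux Uy nUx nUy [[Uxb Uyb] bpfeas bpmin]
  zsol _ mult dual|].
  (* The objective sees only [(x, y)], so [z], [u], [v] need no localisation. *)
  exists (Ux `*` Uy `*` setT `*` setT `*` setT).
    by do 3!apply: nbhs_setXT; exists (Ux, Uy).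
  split=> [||[[[[x y] z] u] v] feas [[[[Uxx Uyy] _] _] _]]//.
    exact: multipliers_MDP_feasible.
  apply: bpmin => //; apply: weak_duality_BP_feasible feas => //.
  exact: dual.
move=> xb yb zb ub vb Ux Uy Uz nUx nUy nUz Uyz.
move=> [[[[[Uxb Uyb] _] _] _] feas mdpmin] cq dual.
exists (Ux `*` Uy); first by exists (Ux, Uy).
split=> [||[x y] bpfeas [Uxx Uyy]]//.
  (* Duality at [xb] places [yb] in the lower-level solution set. *)
  exact: weak_duality_BP_feasible feas.
have [u [v mult]] : exists u v, lagrange_multipliers f g h x y u v.
  apply: guignard_lagrange_multipliers => //; first exact: bpfeas.2.
  exact: cq bpfeas.2.
(* Taking [z = y] keeps the lifted point in the neighbourhood, as [Uy] lies in [Uz]; [u] and [v]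
   range over whole spaces, so the multipliers need no bound. *)
apply: (mdpmin (x, y, y, u, v)).
  by apply: multipliers_MDP_feasible => //; exact: bpfeas.2.
by do !split=> //; exact: Uyz.
Qed.
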